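(* Let $\mu\geq 1$, $u\geq 1$, $x\geq 3$ and $\ell_1,\ldots,\ell_u\geq 3$ be integers, and let $w\geq 1$, $\epsilon\in\{1,2\}$ with $x+\mu\sum_{i=1}^u\ell_i=2w+\epsilon$. If $OP(x,{}^{\mu}\ell_1,\ldots,{}^{\mu}\ell_u)$ (of order $2w+\epsilon$) has a solution, then $OP(y,\ell_1,\ldots,\ell_u)$ has a solution, where $y=2w\mu+\epsilon-\sum_{i=1}^u\ell_i$.
   Context: $K_v^*$ is $K_v$ for $v$ odd and $K_v$ minus a $1$-factor for $v$ even. A solution to $OP(F)$, $F$ a $2$-regular graph of order $v$, is a decomposition of $E(K_v^* )$ into spanning subgraphs isomorphic to $F$. $OP(m_1,\ldots,m_s)$ denotes $OP(F)$ with $F$ $2$-regular with cycle lengths $m_1,\ldots,m_s$; $OP(x,{}^{\mu}\ell_1,\ldots,{}^{\mu}\ell_u)$ denotes the case of one $x$-cycle and $\mu$ cycles of length $\ell_i$ for each $i$. *)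

(* Defs.v *)
From mathcomp Require Import all_boot.
Set Implicit Arguments. Unset Strict Implicit. Unset Printing Implicit Defensive.

Definition Kv_edges (v : nat) : {set {set 'I_v}} :=
  [set e : {set 'I_v} | #|e| == 2].

Definition one_factor (v : nat) (M : {set {set 'I_v}}) : Prop :=
  M \subset Kv_edges v /\ forall z : 'I_v, #|[set e in M | z \in e]| = 1.

Definition cycle_edges (v : nat) (c : seq 'I_v) : {set {set 'I_v}} :=
  [set [set p.1; p.2] | p in zip c (rot 1 c)].

(* H is (the edge set of) a spanning 2-regular subgraph of K_v whose cycles
   have lengths ms (as a list; any order may be realised by reordering cs).
   Every such graph is isomorphic to the 2-regular graph F with cycle lengths
   ms, and conversely. *)
Definition two_factor_of_type (v : nat) (ms : seq nat) (H : {set {set 'I_v}})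
  : Prop :=
  exists cs : seq (seq 'I_v),
    [/\ map size cs = ms,
        all (fun c => 3 <= size c) cs,
        perm_eq (flatten cs) (enum 'I_v) &
        H = \bigcup_(c <- cs) cycle_edges c].

Definition OP_solvable (v : nat) (ms : seq nat) : Prop :=
  exists I : {set {set 'I_v}},
    (odd v -> I = set0) /\ (~~ odd v -> one_factor I) /\
    exists Fs : seq {set {set 'I_v}},
      [/\ forall F, F \in Fs -> two_factor_of_type ms F,
          forall i j, i < size Fs -> j < size Fs -> i != j ->
            [disjoint nth set0 Fs i & nth set0 Fs j] &
          \bigcup_(F <- Fs) F = Kv_edges v :\: I].

(* Main.v *)
Require Import Defs.
From mathcomp Require Import all_boot zify.
Set Implicit Arguments. Unset Strict Implicit. Unset Printing Implicit Defensive.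

(** The case [mu = 1] is trivial. Otherwise split the small cycles of each of
    the [w] given 2-factors into [mu] groups with cycle lengths [ls]. This gives
    [w * mu] colours; the long cycle is cut into a path, which goes to the first
    colour of its factor, and one edge, which goes to the second. The given
    [K_v^*] is now edge-coloured so that each colour consists of closed cycles of
    lengths [ls] and of at most [V - v] paths (isolated vertices included), where
    [V = 2 w mu + eps]. The [V - v] missing vertices are then added one at a time
    as in the amalgamation method of Hilton and Johnson. While [n] vertices are
    missing, every colour has exactly [n] "petals": its paths, and empty words
    standing for the future edges between missing vertices. A new vertex [t]
    joins two different petals of each colour, and sees each old vertex in
    exactly one colour. Such a choice is a perfect matching of a bipartite graph
    that carries constant row and column sums, so it exists by Hall's theorem.
    When one vertex is missing, each colour has a single petal, which the last
    vertex closes into the long cycle. *)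

(** * Hall's theorem *)

Section Hall.
Variables (L R : finType) (y0 : R).
Implicit Types (e : L -> R -> bool) (A X : {set L}).

Definition nbh e A : {set R} := [set y | [exists x in A, e x y]].

Lemma nbhP e A y : reflect (exists2 x, x \in A & e x y) (y \in nbh e A).
Proof. by rewrite inE; apply: exists_inP. Qed.

(** Strong induction on [#|X|], split on whether some proper nonempty subset is tight, that is, has
    no more neighbours than elements. The point [y0] only serves as the value outside [X]. *)
Lemma hall_on e X :
  (forall A, A \subset X -> #|A| <= #|nbh e A|) ->
  exists2 g : L -> R, {in X &, injective g} & {in X, forall x, e x (g x)}.
Proof.
have [n] := ubnP #|X|; elim: n => // n IH in e X *; rewrite ltnS => leXn hX.
have [->|[x0 x0X]] := set_0Vmem X.
  by exists (fun=> y0) => [x y|x]; rewrite inE.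
case: (boolP [exists A : {set L},
  [&& A \proper X, A != set0 & #|nbh e A| <= #|A|]]) => [|noA].
- case/existsP=> A /and3P[pAX A0 leA].
  have sAX := proper_sub pAX.
  have [g1 i1 e1] : exists2 g : L -> R, {in A &, injective g} &
      {in A, forall x, e x (g x)}.
    apply: IH => [|B sBA]; first exact: leq_trans (proper_card pAX) leXn.
    by apply: hX; apply: subset_trans sBA sAX.
  (* For a tight [A], match [A] into its neighbourhood and the rest outside it: Hall's condition for
     [A :|: B] in [e] gives the one for [B] in [e']. *)
  pose e' x y := e x y && (y \notin nbh e A).
  have [g2 i2 e2] : exists2 g : L -> R, {in X :\: A &, injective g} &
      {in X :\: A, forall x, e' x (g x)}.
    apply: IH => [|B].
      have := cardsID A X; rewrite (setIidPr sAX).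
      by move: A0; rewrite -card_gt0; lia.
    rewrite subsetD => /andP[sBX dBA].
    have /hX : A :|: B \subset X by rewrite subUset sAX.
    have -> : nbh e (A :|: B) = nbh e A :|: nbh e' B.
      apply/setP=> y; rewrite in_setU; apply/nbhP/orP.
        case=> x; rewrite in_setU => /orP[xA|xB] exy.
          by left; apply/nbhP; exists x.
        case: (boolP (y \in nbh e A)) => [|yA]; first by left.
        by right; apply/nbhP; exists x; rewrite // /e' exy.
      case=> /nbhP[x xA].
        by exists x; rewrite // in_setU xA.
      by case/andP=> exy _; exists x; rewrite // in_setU xA orbT.
    move/leq_trans/(_ (leq_card_setU _ _)).
    have := cardsUI A B; rewrite setIC (disjoint_setI0 dBA) cards0.
    by move: leA; lia.
  exists (fun x => if x \in A then g1 x else g2 x) => [x y xX yX|x xX].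
    have in2 z : z \in X -> z \notin A -> z \in X :\: A.
      by move=> zX zA; rewrite inE zA.
    have Ng z : z \in X -> z \notin A -> g2 z \notin nbh e A.
      by move=> zX zA; have /andP[] := e2 _ (in2 _ zX zA).
    have Yg z : z \in A -> g1 z \in nbh e A.
      by move=> zA; apply/nbhP; exists z; rewrite ?e1.
    case: ifPn => xA; case: ifPn => yA E.
    + exact: i1.
    + by have := Ng _ yX yA; rewrite -E Yg.
    + by have := Ng _ xX xA; rewrite E Yg.
    + by apply: i2; rewrite // in2.
  case: ifPn => xA; first exact: e1.
  by have /andP[] : e' x (g2 x) by apply: e2; rewrite inE xA.
(* Without a tight set, every proper nonempty subset has a spare neighbour. So [x0] may take any
   neighbour [y], and deleting [y] keeps Hall's condition on [X :\ x0]. *)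
have [y /nbhP[_ /set1P-> ex0y]] : exists y, y \in nbh e [set x0].
  have := hX [set x0]; rewrite sub1set cards1 => /(_ x0X) /card_gt0P[y yN].
  by exists y.
pose e' x z := e x z && (z != y).
have [g ig eg] : exists2 g : L -> R, {in X :\ x0 &, injective g} &
      {in X :\ x0, forall x, e' x (g x)}.
  apply: IH => [|A sA]; first by move: leXn; rewrite (cardsD1 x0 X) x0X.
  have [->|A0] := eqVneq A set0; first by rewrite cards0.
  have pA : A \proper X.
    apply: sub_proper_trans sA _.
    by apply/properP; split; [exact: subsetDl|exists x0; rewrite ?inE ?eqxx].
  move: noA; rewrite negb_exists => /forallP/(_ A).
  rewrite pA A0 /= -ltnNge => ltA.
  have -> : nbh e' A = nbh e A :\ y.
    apply/setP=> z; rewrite in_setD1; apply/nbhP/andP.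
      by case=> x xA /andP[exz zy]; split=> //; apply/nbhP; exists x.
    by case=> zy /nbhP[x xA exz]; exists x; rewrite // /e' exz.
  by have := cardsD1 y (nbh e A); lia.
have inD z : z \in X -> z != x0 -> z \in X :\ x0 by move=> *; apply/setD1P.
have Ng z : z \in X -> z != x0 -> g z != y.
  by move=> zX zx; have /andP[] := eg _ (inD _ zX zx).
exists (fun x => if x == x0 then y else g x) => [x z xX zX|x xX].
  case: eqVneq => [->|xx]; case: eqVneq => [->//|zx] E.
  - by have := Ng _ zX zx; rewrite -E eqxx.
  - by have := Ng _ xX xx; rewrite E eqxx.
  - by apply: ig; rewrite // inD.
case: eqVneq => [->//|xx]; by have /andP[] := eg _ (inD _ xX xx).
Qed.

End Hall.

(** The common sum [D] forces [#|L| = #|R|]. The weight [D * #|A|] of the rows of [A] lies in the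
    columns of its neighbourhood, each of total [D], which is Hall's condition. *)
Lemma regular_perfect_matching (L R : finType) (D : nat) (f : L -> R -> nat) :
  0 < D -> (forall x, \sum_y f x y = D) -> (forall y, \sum_x f x y = D) ->
  exists2 g : L -> R, bijective g & forall x, 0 < f x (g x).
Proof.
move=> D0 rowD colD.
have cardLR : #|L| = #|R|.
  apply/eqP; rewrite -(eqn_pmul2r D0) -!sum_nat_const.
  rewrite -(eq_bigr _ (fun x _ => rowD x)) -(eq_bigr _ (fun y _ => colD y)).
  by rewrite exchange_big.
(* [hall_on] needs a default value in [R]; if [R] is empty, so is [L]. *)
have [R0|[y0 _]] := set_0Vmem [set: R].
  have L0 (x : L) : False.
    by have := fintype0 x; rewrite cardLR -cardsT R0 cards0; apply.
  have f0 (x : L) : R by case: (L0 x).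
  exists f0 => [|x]; last by case: (L0 x).
  apply: inj_card_bij; last by rewrite cardLR.
  by move=> x; case: (L0 x).
pose e x y := 0 < f x y.
have [A _|g ig eg] := @hall_on L R y0 e setT.
  rewrite -(leq_pmul2r D0) -!sum_nat_const.
  rewrite -(eq_bigr _ (fun x _ => rowD x)) -(eq_bigr _ (fun y _ => colD y)).
  have -> : \sum_(i in A) \sum_y f i y = \sum_(i in A) \sum_(y in nbh e A) f i y.
    apply: eq_bigr => x xA; rewrite [LHS](bigID (mem (nbh e A))) /=.
    rewrite [X in _ + X]big1 ?addn0 // => y /negP yN.
    apply/eqP; rewrite -leqn0 leqNgt; apply/negP=> fxy; apply: yN.
    by apply/nbhP; exists x.
  rewrite exchange_big; apply: leq_sum => y _.
  by rewrite [X in _ <= X](bigID (mem A)) leq_addr.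
exists g => [|x]; last by apply: eg; rewrite inE.
by apply: inj_card_bij; [move=> x y; apply: ig; rewrite inE|rewrite cardLR].
Qed.

(** * Words and their adjacency counts *)

Section Words.
Variable T : eqType.
Implicit Types (x y z a b : T) (s p q : seq T).

(* All adjacency counts are multiplicities of the unordered pair {a, b}:
   [padj] and [adj] read a word as a path, [cadj] as a closed cycle. *)
Definition joins x y a b : nat := (x == a) && (y == b) + (x == b) && (y == a).

Fixpoint padj x s a b : nat :=
  if s is y :: s' then joins x y a b + padj y s' a b else 0.

Definition adj p a b := if p is x :: s then padj x s a b else 0.
Definition cadj p a b := if p is x :: s then padj x (rcons s x) a b else 0.
(** A one-letter word has its letter as both ends and the empty word has no end. With this
    convention degree plus [ends] is twice the multiplicity for every word, as in [sum_adj]. *)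
Definition ends p a : nat :=
  if p is x :: s then (x == a) + (last x s == a) else 0.

Lemma joinsC x y a b : joins x y a b = joins x y b a.
Proof. by rewrite /joins addnC. Qed.

Lemma joins_swap x y a b : joins y x a b = joins x y a b.
Proof. by rewrite /joins addnC; congr (_ + _); rewrite andbC. Qed.

Lemma padjC x s a b : padj x s a b = padj x s b a.
Proof. by elim: s x => //= y s IH x; rewrite joinsC IH. Qed.

Lemma adjC p a b : adj p a b = adj p b a.
Proof. by case: p => //= x s; rewrite padjC. Qed.

Lemma cadjC p a b : cadj p a b = cadj p b a.
Proof. by case: p => //= x s; rewrite padjC. Qed.

Lemma padj_cat x s1 s2 a b :
  padj x (s1 ++ s2) a b = padj x s1 a b + padj (last x s1) s2 a b.
Proof. by elim: s1 x => //= y s IH x; rewrite IH addnA. Qed.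

Lemma padj_rcons x s y a b :
  padj x (rcons s y) a b = padj x s a b + joins (last x s) y a b.
Proof. by rewrite -cats1 padj_cat /= addn0. Qed.

Lemma adj_rev p a b : adj (rev p) a b = adj p a b.
Proof.
elim: p => //= x s IH; rewrite rev_cons.
case: s IH => //= y s; rewrite rev_cons; case: (rev s) => [|z r] /= <-.
  by rewrite !addn0 joins_swap.
by rewrite !padj_rcons /= last_rcons addnC (joins_swap x y).
Qed.

Lemma padj_notin x s a b : a \notin x :: s -> padj x s a b = 0.
Proof.
elim: s x => //= y s IH x; rewrite inE negb_or eq_sym => /andP[/negPf nx ny].
have := ny; rewrite inE negb_or eq_sym => /andP[/negPf n2 _].
by rewrite IH // /joins nx n2 andbF.
Qed.

Lemma adj_notin p a b : a \notin p -> adj p a b = 0.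
Proof. by case: p => //= x s; apply: padj_notin. Qed.

Lemma cadj_notin p a b : a \notin p -> cadj p a b = 0.
Proof.
by case: p => // x s nx /=; rewrite padj_notin // inE mem_rcons orbA orbb -in_cons.
Qed.

Lemma padj_diag x s a : uniq (x :: s) -> padj x s a a = 0.
Proof.
elim: s x => //= y s IH x; rewrite inE negb_or.
move=> /andP[/andP[xy xs] us]; rewrite IH // /joins addn0.
by case: eqVneq => // <-; rewrite eq_sym (negPf xy).
Qed.

Lemma adj_diag p a : uniq p -> adj p a a = 0.
Proof. by case: p => //= x s; apply: padj_diag. Qed.

Lemma cadj_diag p a : uniq p -> 1 < size p -> cadj p a a = 0.
Proof.
case: p => //= x s u; rewrite padj_rcons padj_diag //.
case: (lastP s) u => // {}s y u _; rewrite last_rcons /joins /= add0n.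
move: u; rewrite mem_rcons inE negb_or => /andP[/andP[xy _] _].
by case: (eqVneq y a) => // <-; rewrite (negPf xy).
Qed.

Definition olast s : option T := if s is x :: s' then Some (last x s') else None.

(** Reversal preserves [adj], so a path can be turned until the chosen end comes last; [None] is the
    choice for the empty word. *)
Lemma orient_word p (o : option T) :
  (if o is Some a then 0 < ends p a else p == [::]) ->
  exists q, [/\ perm_eq q p, forall a b, adj q a b = adj p a b & olast q = o].
Proof.
case: o => [a|/eqP->]; last by exists [::].
case: p => //= x s; case: (eqVneq (last x s) a) => [<-|na].
  by exists (x :: s).
case: (eqVneq x a) => // <- _; exists (rev (x :: s)); split.
- by rewrite perm_rev.
- exact: adj_rev.
- by rewrite rev_cons; case: (rev s) => //= z r; rewrite last_rcons.
Qed.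

(** The new vertex [t] gains exactly the last letters of [p] and [q] as neighbours. An empty word
    contributes none and leaves [t] as an end of the new path. *)
Lemma adj_join p q t a b : t \notin p -> t \notin q ->
  adj (p ++ t :: rev q) a b = adj p a b + adj q a b +
    ((olast p == Some a) + (olast q == Some a)) * (b == t) +
    ((olast p == Some b) + (olast q == Some b)) * (a == t).
Proof.
move=> tp tq.
have E1 : adj (p ++ t :: rev q) a b = adj (rcons p t) a b + adj (rcons q t) a b.
  have -> : adj (rcons q t) a b = adj (t :: rev q) a b.
    by rewrite -adj_rev rev_rcons.
  by case: p tp => //= x s _; rewrite padj_cat /= padj_rcons addnA.
have E2 r : t \notin r -> adj (rcons r t) a b = adj r a b +
    ((olast r == Some a) * (b == t) + (olast r == Some b) * (a == t)).
  case: r => //= x s _; rewrite padj_rcons /joins !(eq_sym t).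
  by rewrite !mulnb.
by rewrite E1 !E2 // ; lia.
Qed.

End Words.

Lemma padj_map (T U : eqType) (f : T -> U) (x : T) s a b : injective f ->
  padj (f x) (map f s) (f a) (f b) = padj x s a b.
Proof. by move=> fi; elim: s x => //= y s IH x; rewrite IH /joins !(inj_eq fi). Qed.

Lemma adj_map (T U : eqType) (f : T -> U) p a b : injective f ->
  adj (map f p) (f a) (f b) = adj p a b.
Proof. by case: p => //= x s fi; rewrite padj_map. Qed.

Lemma cadj_map (T U : eqType) (f : T -> U) p a b : injective f ->
  cadj (map f p) (f a) (f b) = cadj p a b.
Proof. by case: p => //= x s fi; rewrite -map_rcons padj_map. Qed.

Lemma sum_ord_eq r a : a < r -> \sum_(b < r) (a == b) = 1.
Proof.
move=> ar; rewrite (bigD1 (Ordinal ar)) //= eqxx big1 // => i ni.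
by rewrite -(inj_eq val_inj) /= in ni; rewrite eq_sym (negPf ni).
Qed.

Lemma sum_joins r x y a : x < r -> y < r ->
  \sum_(b < r) joins x y a b = (x == a) + (y == a).
Proof.
move=> xr yr; rewrite /joins big_split /=; congr (_ + _).
  by case: eqP => _ /=; rewrite ?big1_eq ?sum_ord_eq.
by case: (y == a); under eq_bigr do rewrite ?andbF ?andbT; rewrite ?big1_eq ?sum_ord_eq.
Qed.

Lemma sum_padj r x s a : all (gtn r) (x :: s) ->
  \sum_(b < r) padj x s a b + ((x == a) + (last x s == a)) = (count_mem a (x :: s)).*2.
Proof.
elim: s x => [|y s IH] x /=; first by case: eqP => _ _; rewrite big1_eq.
case/and3P=> xr yr sr; rewrite big_split /= sum_joins //.
by have := IH y; rewrite /= yr sr => /(_ isT); lia.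
Qed.

Lemma sum_adj r p a : all (gtn r) p ->
  \sum_(b < r) adj p a b + ends p a = (count_mem a p).*2.
Proof. by case: p => [|x s] /= H; rewrite ?big1_eq // sum_padj. Qed.

Lemma sum_cadj r p a : all (gtn r) p ->
  \sum_(b < r) cadj p a b = (count_mem a p).*2.
Proof.
case: p => [|x s] /=; first by rewrite big1_eq.
case/andP=> xr sr; have := @sum_padj r x (rcons s x) a.
rewrite /= all_rcons /= xr sr last_rcons => /(_ isT).
by rewrite -cats1 count_cat /=; lia.
Qed.

Lemma sum_count_flatten (T : eqType) (a : T) (ps : seq (seq T)) :
  \sum_(p <- ps) count_mem a p = count_mem a (flatten ps).
Proof. by rewrite count_flatten sumnE big_map. Qed.

Lemma sum_ends r p : all (gtn r) p -> \sum_(a < r) ends p a = (p != [::]).*2.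
Proof.
case: p => [|x s] /=; first by rewrite big1_eq.
case/andP=> xr sr; rewrite big_split /= !sum_ord_eq //.
by case: (lastP s) sr => // {}s y; rewrite last_rcons all_rcons => /andP[].
Qed.

Lemma sum_count_ord r (s : seq nat) : all (gtn r) s ->
  \sum_(a < r) count_mem (a : nat) s = size s.
Proof.
elim: s => [|x s IH] /=; first by rewrite big1_eq.
by case/andP=> xr sr; rewrite big_split /= sum_ord_eq // IH.
Qed.

(** * Partial solutions *)

(* [r] vertices [0..r-1] are present and [n] are missing. Colour [c] has closed
   cycles [K c] and petals [P c]. If [b] holds there is also a 1-factor to build:
   [M] lists its edges, [J] the vertices whose partner is still missing, and [k]
   is the number of its edges between missing vertices. *)
Record partial_OP (C : nat) (b : bool) (K : 'I_C -> seq (seq nat)) (r n : nat)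
    (P : 'I_C -> seq (seq nat)) (M : seq (seq nat)) (J : seq nat) (k : nat)
    : Prop := PartialOP {
  po_size : forall c, size (P c) = n;
  po_perm : forall c, perm_eq (flatten (K c) ++ flatten (P c)) (iota 0 r);
  po_pairs : all (fun m => size m == 2) M;
  po_match : perm_eq (J ++ flatten M) (iota 0 (b * r));
  po_half : size J + k.*2 = b * n;
  po_cover : forall a d, a < r -> d < r -> a != d ->
    \sum_c \sum_(y <- K c) cadj y a d + \sum_c \sum_(p <- P c) adj p a d
    + \sum_(m <- M) adj m a d = 1 }.

(** * Degree counts in a partial solution *)

Section Partial.
Variables (C : nat) (b : bool) (K : 'I_C -> seq (seq nat)).
Hypothesis K_size : forall c y, y \in K c -> 1 < size y.
Variables (r n : nat) (P : 'I_C -> seq (seq nat)) (M : seq (seq nat)).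
Variables (J : seq nat) (k : nat).
Hypothesis po : partial_OP b K r n P M J k.

Lemma lt_K c y z : y \in K c -> z \in y -> z < r.
Proof.
move=> yK zy; have := perm_mem (po_perm po c) z.
rewrite mem_iota mem_cat add0n /= => <-; apply/orP; left.
by apply/flattenP; exists y.
Qed.

Lemma lt_P c y z : y \in P c -> z \in y -> z < r.
Proof.
move=> yK zy; have := perm_mem (po_perm po c) z.
rewrite mem_iota mem_cat add0n /= => <-; apply/orP; right.
by apply/flattenP; exists y.
Qed.

Lemma lt_JM z : z \in J ++ flatten M -> z < r.
Proof.
by rewrite (perm_mem (po_match po)) mem_iota; case: b; rewrite ?mul1n ?mul0n.
Qed.

Lemma uniq_KP c y : y \in K c ++ P c -> uniq y.
Proof.
move=> yK; have := perm_uniq (po_perm po c); rewrite iota_uniq -flatten_cat.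
elim: (_ ++ _) yK => //= z s IH; rewrite inE cat_uniq => /orP[/eqP->|/IH {}IH].
  by case/and3P.
by case/and3P=> _ _.
Qed.

Lemma uniq_M y : y \in M -> uniq y.
Proof.
move=> yM; have := perm_uniq (po_match po); rewrite iota_uniq.
rewrite cat_uniq => /and3P[_ _].
elim: M yM => //= z s IH; rewrite inE cat_uniq => /orP[/eqP->|/IH {}IH].
  by case/and3P.
by case/and3P=> _ _.
Qed.

Let cov a d := \sum_c \sum_(y <- K c) cadj y a d
  + \sum_c \sum_(p <- P c) adj p a d + \sum_(m <- M) adj m a d.

(** [H a] stands for the number of edges from the new vertex [r] to [a]. The old words do not
    contain [r], so these are its only edges. This serves both for adding an intermediate vertex and
    for the final closing. *)
Lemma cover_extend (H : nat -> nat) : (forall a, a < r -> H a = 1) ->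
  forall a d, a < r.+1 -> d < r.+1 -> a != d ->
  cov a d + H a * (d == r) + H d * (a == r) = 1.
Proof.
move=> H1.
have cov0 a : cov r a = 0.
  rewrite /cov [X in X + _ + _]big1 ?[X in _ + X + _]big1 => [|c _|c _].
  - rewrite big1_seq // => p /andP[_ pM]; rewrite adj_notin //.
    apply/negP=> rp; suff: r < r by rewrite ltnn.
    by apply: lt_JM; rewrite mem_cat; apply/orP; right; apply/flattenP; exists p.
  - rewrite big1_seq // => p /andP[_ pP]; rewrite adj_notin //.
    by apply/negP=> rp; have := lt_P pP rp; rewrite ltnn.
  - rewrite big1_seq // => p /andP[_ pP]; rewrite cadj_notin //.
    by apply/negP=> rp; have := lt_K pP rp; rewrite ltnn.
have covC a d : cov a d = cov d a.
  rewrite /cov; congr (_ + _ + _); last by apply: eq_bigr => p _; apply: adjC.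
    by apply: eq_bigr => c _; apply: eq_bigr => y _; apply: cadjC.
  by apply: eq_bigr => c _; apply: eq_bigr => p _; apply: adjC.
move=> a d; rewrite !ltnS => ar dr nad.
case: (eqVneq a r) => [Ea|na].
  have nd : d != r by rewrite eq_sym -Ea.
  by rewrite Ea cov0 (negPf nd) muln0 muln1 H1 // ltn_neqAle nd.
have lar : a < r by rewrite ltn_neqAle na.
case: (eqVneq d r) => [->|nd].
  by rewrite covC cov0 muln0 muln1 H1.
by rewrite !muln0 !addn0 /cov (po_cover po) // ltn_neqAle nd.
Qed.

Lemma matching_degree a :
  \sum_(d < r) \sum_(m <- M) adj m a d = count_mem a (flatten M).
Proof.
rewrite exchange_big /= -sum_count_flatten; apply: eq_big_seq => m mM.
have /sum_adj-/(_ a) : all (gtn r) m.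
  apply/allP=> z zm; apply: lt_JM; rewrite mem_cat; apply/orP; right.
  by apply/flattenP; exists m.
have /eqP := allP (po_pairs po) _ mM; case: m {mM} => [|x [|y [|]]] //= _; lia.
Qed.

(** Count the [r.-1] edges at [a] by colour: each colour contributes two minus the number of ends at
    [a], and the 1-factor contributes [b] minus the multiplicity of [a] in [J]. *)
Lemma degree_total a : a < r ->
  \sum_c \sum_(p <- P c) ends p a + count_mem a J + r = C.*2 + b + 1.
Proof.
move=> ar.
have covr : \sum_(d < r) cov a d = r.-1.
  rewrite (bigD1 (Ordinal ar)) //=.
  rewrite (eq_bigr (fun=> 1)) => [|d nd]; last first.
    rewrite /cov (po_cover po) //; apply: contra nd => /eqP E.
    by apply/eqP/val_inj.
  rewrite sum1dep_card (_ : #|_| = r.-1); last first.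
    have := cardC1 (Ordinal ar); rewrite card_ord => <-.
    by apply: eq_card => d; rewrite !inE.
  suff -> : cov a a = 0 by [].
  rewrite /cov [X in X + _ + _]big1 ?[X in _ + X + _]big1 => [|c _|c _].
  - by rewrite big1_seq // => m /andP[_ mM]; rewrite adj_diag // (uniq_M mM).
  - rewrite big1_seq // => p /andP[_ pP].
    by rewrite adj_diag // (@uniq_KP c) // mem_cat pP orbT.
  - rewrite big1_seq // => y /andP[_ yK].
    by rewrite cadj_diag ?(K_size yK) // (@uniq_KP c) // mem_cat yK.
have cK : \sum_(d < r) \sum_c \sum_(y <- K c) cadj y a d =
   \sum_c (count_mem a (flatten (K c))).*2.
  rewrite exchange_big; apply: eq_bigr => c _; rewrite exchange_big /=.
  rewrite -sum_count_flatten -mul2n big_distrr /=.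
  apply: eq_big_seq => y yK; rewrite sum_cadj ?mul2n //.
  by apply/allP => z; apply: lt_K yK.
have cP : \sum_(d < r) \sum_c \sum_(p <- P c) adj p a d
   + \sum_c \sum_(p <- P c) ends p a = \sum_c (count_mem a (flatten (P c))).*2.
  rewrite exchange_big -big_split; apply: eq_bigr => c _; rewrite exchange_big /=.
  rewrite -sum_count_flatten -mul2n big_distrr -big_split /=.
  apply: eq_big_seq => y yK; rewrite sum_adj ?mul2n //.
  by apply/allP => z; apply: lt_P yK.
have cKP : \sum_c (count_mem a (flatten (K c))).*2
   + \sum_c (count_mem a (flatten (P c))).*2 = C.*2.
  rewrite -big_split /= -[in RHS](card_ord C) -muln2 -sum_nat_const.
  apply: eq_bigr => c _; rewrite -doubleD -count_cat.
  by rewrite (permP (po_perm po c)) count_uniq_mem ?iota_uniq // mem_iota ar.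
have cJ : count_mem a J + count_mem a (flatten M) = b.
  rewrite -count_cat (permP (po_match po)) count_uniq_mem ?iota_uniq //.
  by rewrite mem_iota add0n; case: b; rewrite ?mul1n ?ar ?mul0n.
move: covr; rewrite !big_split /= cK matching_degree.
move: cP cKP cJ ar {cK}.
set sA := \sum_(d < r) _; set sE := \sum_c \sum_(p <- P c) _.
set sP := \sum_c _.*2; set sK := \sum_c _.*2.
by move: sA sE sP sK (count_mem a J) (count_mem a (flatten M)); lia.
Qed.

Hypothesis rn : r + n = C.*2 + b + 1.

(** Each end at [a], and each occurrence of [a] in [J], is reserved for one edge from [a] to a
    missing vertex. *)
Lemma ends_total a : a < r ->
  \sum_c \sum_(p <- P c) ends p a + count_mem a J = n.
Proof. by move/degree_total; rewrite -rn [r + n]addnC => /addIn. Qed.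

(** The empty petals and [k] together account for the edges of the complete graph on the missing
    vertices. To see this, sum [ends_total] over all old vertices: each nonempty petal has two ends,
    and there are [C * n] petals in all. *)
Lemma empty_total :
  (\sum_c count_mem [::] (P c) + k).*2 = n * n.-1.
Proof.
have E : \sum_(a < r) (\sum_c \sum_(p <- P c) ends p a + count_mem (a : nat) J) = r * n.
  by rewrite (eq_bigr (fun=> n)) ?sum_nat_const ?card_ord // => a _; rewrite ends_total.
move: E; rewrite big_split /= sum_count_ord; last first.
  by apply/allP=> z zJ; apply: lt_JM; rewrite mem_cat zJ.
have -> : \sum_(a < r) \sum_c \sum_(p <- P c) ends p a =
   \sum_c (count (predC1 [::]) (P c)).*2.
  rewrite exchange_big; apply: eq_bigr => c _; rewrite exchange_big /=.
  rewrite -sum1_count -mul2n big_distrr /= [RHS]big_mkcond /=.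
  apply: eq_big_seq => p pP; rewrite sum_ends; first by case: eqP.
  by apply/allP=> z; apply: lt_P pP.
have : \sum_c count_mem [::] (P c) + \sum_c count (predC1 [::]) (P c) = C * n.
  rewrite -big_split /= -[in RHS](card_ord C) -sum_nat_const.
  by apply: eq_bigr => c _; rewrite count_predC (po_size po).
under [X in _ -> X + _ = _ -> _]eq_bigr do rewrite -mul2n.
rewrite -big_distrr /=.
move: (po_half po) rn; set x := \sum_c _; set y := \sum_c _.
by nia.
Qed.

End Partial.

(** * Merging two petals through a new vertex *)

Lemma perm_two_nth (T : eqType) (x0 : T) (s : seq T) i j :
  i < size s -> j < size s -> i != j ->
  exists rest, perm_eq s [:: nth x0 s i, nth x0 s j & rest].
Proof.
wlog ltij : i j / i < j.
  move=> H si sj nij; case: (ltngtP i j) => [ij|ji|E].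
  - exact: H.
  - have [|rest Hr] := H j i ji sj si; first by rewrite eq_sym.
    exists rest; apply: perm_trans Hr _.
    by rewrite (perm_catCA [:: _] [:: _] rest).
  - by rewrite E eqxx in nij.
move=> si sj _.
exists (take i s ++ take (j - i.+1) (drop i.+1 s) ++ drop j.+1 s).
rewrite -[X in perm_eq X](cat_take_drop i s) (drop_nth x0 si).
rewrite -[X in _ ++ _ :: X](cat_take_drop (j - i.+1)) drop_drop.
rewrite (subnK ltij) (drop_nth x0 sj).
apply/permP=> a; rewrite !(count_cat, count_cat) /= !count_cat /=; lia.
Qed.

(** Here [o] records how [t] uses the petals of one colour. Exactly two of the [m.+2] are used; they
    are turned so that the chosen ends meet [t] and become one petal, which leaves [m.+1]. A used
    empty petal makes [t] an end, reserved for an edge to a missing vertex. *)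
Lemma merge_words (P : seq (seq nat)) (t m : nat)
    (o : 'I_m.+2 -> option (option nat)) :
  size P = m.+2 -> t \notin flatten P -> #|[set i | o i == None]| = m ->
  (forall i a, o i = Some (Some a) -> 0 < ends (nth [::] P i) a) ->
  (forall i, o i = Some None -> nth [::] P i = [::]) ->
  exists P', [/\ size P' = m.+1, perm_eq (flatten P') (t :: flatten P) &
    forall a d, \sum_(p <- P') adj p a d = \sum_(p <- P) adj p a d
      + (\sum_i (o i == Some (Some a))) * (d == t)
      + (\sum_i (o i == Some (Some d))) * (a == t)].
Proof.
move=> sP tP cN oS oN.
have /eqP/cards2P[i [j [nij Eij]]] : #|[set i | o i != None]| = 2.
  have := cardsC [set i | o i == None]; rewrite cN card_ord.
  have -> : ~: [set i | o i == None] = [set i | o i != None].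
    by apply/setP=> z; rewrite !inE.
  by lia.
have inD z : (o z != None) = (z == i) || (z == j).
  by have := in_set (fun z => o z != None) z; rewrite Eij !inE.
have [|||rest Hr] := @perm_two_nth _ [::] P i j; rewrite ?sP //.
set p := nth _ P i in Hr; set q := nth _ P j in Hr.
have ori z : o z != None -> exists w, [/\ perm_eq w (nth [::] P z),
    forall a b, adj w a b = adj (nth [::] P z) a b & Some (olast w) = o z].
  case E : (o z) => [y|//] _.
  have [|w [w1 w2 w3]] := @orient_word _ (nth [::] P z) y.
    case: y E => [a|] E; first exact: oS E.
    by rewrite oN.
  by exists w; split=> //; rewrite w3.
have [|p' [p1 p2 p3]] := ori i; first by rewrite inD eqxx.
have [|q' [q1 q2 q3]] := ori j; first by rewrite inD eqxx orbT.
have tp z : z < size P -> t \notin nth [::] P z.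
  by move=> zP; apply: contra tP => tz; apply/flattenP; exists (nth [::] P z); rewrite ?mem_nth.
have hit a : \sum_z (o z == Some (Some a)) =
    (olast p' == Some a) + (olast q' == Some a).
  rewrite (bigD1 i) //= (bigD1 j) /=; last by rewrite eq_sym.
  rewrite -p3 -q3 big1 ?addn0 //.
  move=> z /andP[zi zj]; have := inD z; rewrite (negPf zi) (negPf zj) /=.
  by move/negbFE/eqP->.
exists ((p' ++ t :: rev q') :: rest); split.
- by have := perm_size Hr; rewrite /= sP => -[->].
- rewrite /= -catA cat_cons; apply/permP=> a /=.
  rewrite (permP (perm_flatten Hr)) /= !(count_cat, count_rev) /= count_cat.
  by rewrite count_rev (permP p1) (permP q1) addnCA.
- move=> a d; rewrite (perm_big _ Hr) /= !big_cons !hit.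
  rewrite adj_join ?(perm_mem p1) ?(perm_mem q1) ?tp ?sP // p2 q2 -/p -/q.
  by lia.
Qed.

Lemma perm_iota_succ r : perm_eq (r :: iota 0 r) (iota 0 r.+1).
Proof. by rewrite -[in X in perm_eq _ X]addn1 iotaD cats1 perm_sym perm_rcons. Qed.

Lemma sum_pair (A B : finType) (F : A * B -> nat) :
  \sum_y F y = \sum_a \sum_d F (a, d).
Proof. by rewrite pair_bigA /=; apply: eq_bigr; case. Qed.

(** * Adding a vertex *)

Section Step.
Variables (C : nat) (b : bool) (K : 'I_C -> seq (seq nat)).
Hypothesis K_size : forall c y, y \in K c -> 1 < size y.
Variables (r m : nat) (P : 'I_C -> seq (seq nat)) (M : seq (seq nat)).
Variables (J : seq nat) (k : nat).
Hypothesis rn : r + m.+2 = C.*2 + b + 1.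
Hypothesis po : partial_OP b K r m.+2 P M J k.

Let L : finType := (('I_C * 'I_m.+2) + 'I_b)%type.
Let R : finType := (('I_r + 'I_m.+1) + ('I_C * 'I_m))%type.

(* [L]: the petals of all colours, and one node for the 1-factor if there is one.
   [R]: the [r] old vertices, [m.+1] slots for the edges from the new vertex to the
   vertices still missing, and [m] slots per colour that absorb its unused petals,
   so that exactly two petals of each colour are used. *)
Definition slot_weight (x : L) (y : R) : nat :=
  match x, y with
  | inl (c, i), inl (inl s) => m.+1 * ends (nth [::] (P c) i) s
  | inl (c, i), inl (inr _) => 2 * (nth [::] (P c) i == [::])
  | inl (c, i), inr (c', _) => m.+1 * (c == c')
  | inr _, inl (inl s) => m.+1 * count_mem (s : nat) J
  | inr _, inl (inr _) => k.*2
  | inr _, inr _ => 0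
  end.

(** A nonempty petal puts [m.+1] on each of its two ends, an empty one puts 2 on each of [m.+1]
    slots. Either way this is [2 * m.+1], and the absorbing slots of its colour add [m * m.+1]. The
    row of the 1-factor is [po_half] times [m.+1]. *)
Lemma slot_weight_row x : \sum_y slot_weight x y = m.+2 * m.+1.
Proof.
rewrite big_sumType /= big_sumType /=.
case: x => [[c i]|z] /=.
  rewrite -big_distrr /= sum_nat_const card_ord sum_ends; last first.
    have pP : nth [::] (P c) i \in P c by rewrite mem_nth // (po_size po).
    by apply/allP=> z; apply: (lt_P po pP).
  rewrite (_ : \sum_(y : 'I_C * 'I_m) _ = m.+1 * m); last first.
    rewrite sum_pair.
    rewrite (bigD1 c) //= sum_nat_const card_ord eqxx muln1 big1 ?addn0 1?mulnC //.
    move=> c' nc; rewrite big1 // => j _.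
    by rewrite eq_sym (negPf nc) muln0.
  by case: eqP => _ /=; nia.
rewrite -big_distrr /= !sum_nat_const !card_ord sum_count_ord; last first.
  by apply/allP=> a aJ; apply: (lt_JM po); rewrite mem_cat aJ.
have := po_half po; have : b by case: b z => // -[].
by move=> -> ; nia.
Qed.

(** The column of an old vertex is [ends_total], that of a missing-vertex slot is [empty_total], and
    an absorbing slot sees the [m.+2] petals of its colour. *)
Lemma slot_weight_col y : \sum_x slot_weight x y = m.+2 * m.+1.
Proof.
have nthE (F : seq nat -> nat) c : \sum_(i < m.+2) F (nth [::] (P c) i) =
    \sum_(p <- P c) F p.
  by rewrite (big_nth [::]) big_mkord (po_size po).
rewrite big_sumType /=.
rewrite sum_pair.
rewrite sum_nat_const card_ord.
case: y => [[s|l]|[c j]] /=.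
- rewrite (eq_bigr (fun c => m.+1 * \sum_(p <- P c) ends p s)) => [|c _]; last first.
    by rewrite -big_distrr /= (nthE (fun p => ends p s)).
  rewrite -big_distrr /=.
  have bJ : b * count_mem (s : nat) J = count_mem (s : nat) J.
    have := po_match po; case: b => [_|]; first by rewrite mul1n.
    by rewrite mul0n /= => /perm_size/eqP; rewrite size_cat addn_eq0 => /andP[/nilP->].
  have := ends_total K_size po rn (ltn_ord s).
  by rewrite mulnCA bJ -mulnDr mulnC => ->.
- rewrite (eq_bigr (fun c => 2 * count_mem [::] (P c))) => [|c _]; last first.
    rewrite -big_distrr /= (nthE (fun p => nat_of_bool (p == [::]))).
    by rewrite -sum1_count [in RHS]big_mkcond; congr (2 * _); apply: eq_bigr => p _; case: eqP.
  rewrite -big_distrr /=.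
  have bk : b * k.*2 = k.*2.
    by have := po_half po; case: b => [_|]; lia.
  by have := empty_total K_size po rn; rewrite /= bk; nia.
- rewrite muln0 addn0 (bigD1 c) //= sum_nat_const card_ord eqxx muln1.
  rewrite big1 ?addn0 // => c' nc; rewrite big1 // => i _.
  by rewrite (negPf nc) muln0.
Qed.

(* [Some (Some s)]: joined to [s]; [Some None]: joined to a missing vertex;
   [None]: petal not used. *)
Definition slot_target (y : R) : option (option nat) :=
  match y with
  | inl (inl s) => Some (Some (val s))
  | inl (inr _) => Some None
  | inr _ => None
  end.

Lemma sum_slot_target a : a < r -> \sum_(y : R) (slot_target y == Some (Some a)) = 1.
Proof.
move=> ar; rewrite big_sumType /= big_sumType /= [X in _ + X]big1 //.
rewrite [X in _ + X + _]big1 // !addn0 -[RHS](sum_ord_eq ar).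
by apply: eq_bigr => s _; rewrite eq_sym.
Qed.

Lemma slot_matching : exists g : L -> option (option nat),
  [/\ forall c i a, g (inl (c, i)) = Some (Some a) -> 0 < ends (nth [::] (P c) i) a,
      forall c i, g (inl (c, i)) = Some None -> nth [::] (P c) i = [::],
      forall c, #|[set i | g (inl (c, i)) == None]| = m,
      forall z, if g (inr z) is Some o then
          if o is Some a then a \in J else 0 < k else false &
      forall a, a < r -> \sum_x (g x == Some (Some a)) = 1].
Proof.
have [//|h hb hp] :=
  regular_perfect_matching (D := m.+2 * m.+1) _ slot_weight_row slot_weight_col.
exists (fun x => slot_target (h x)); split.
- move=> c i a; have := hp (inl (c, i)).
  by case: (h _) => [[s|l]|[c' j]] //=; rewrite muln_gt0 => H [<-].
- move=> c i; have := hp (inl (c, i)).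
  by case: (h _) => [[s|l]|[c' j]] //=; case: eqP.
- move=> c; have [h' hK h'K] := hb.
  have Hd i j c' : h (inl (c, i)) = inr (c', j) -> c' = c.
    by move=> E; have := hp (inl (c, i)); rewrite E /= muln_gt0 /=; case: eqP.
  have Hd' j : exists i, h' (inr (c, j)) = inl (c, i).
    have := hp (h' (inr (c, j))); rewrite h'K.
    case: (h' _) => [[c' i]|//] /=; rewrite muln_gt0 /=; case: eqP => // -> _; by exists i.
  have [u uE] := fin_all_exists Hd'.
  have ui : injective u.
    move=> j1 j2 E; have : h' (inr (c, j1)) = h' (inr (c, j2)) by rewrite !uE E.
    by move/(can_inj h'K) => [].
  rewrite -[RHS](card_ord m) -(card_imset _ ui); apply: eq_card => i.
  rewrite inE; apply/idP/imsetP => [|[j _ ->]].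
    case E: (h _) => [[s|l]|[c' j]] //= _; exists j => //.
    have Ec := Hd _ _ _ E; rewrite Ec in E.
    by have := uE j; rewrite -E hK => -[].
  by have := uE j => /(congr1 h); rewrite h'K => <-.
- by move=> z; have := hp (inr z); case: (h _) => [[s|l]|[c' j]] //=;
    rewrite ?muln_gt0 ?double_gt0 //= -has_count has_pred1.
- move=> a ar; rewrite -[RHS](sum_slot_target ar).
  by rewrite [RHS](reindex h) //; apply: onW_bij.
Qed.

(** The partner of [r] in the 1-factor is either a waiting vertex of [J], which then leaves [J], or
    still missing. In the latter case [r] enters [J], and one of the [k] edges between missing
    vertices now has one end present. *)
Lemma matching_step (o : 'I_b -> option (option nat)) :
  (forall z, if o z is Some y then if y is Some a then a \in J else 0 < k else false) ->
  exists M' J' k', [/\ all (fun m => size m == 2) M',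
    perm_eq (J' ++ flatten M') (iota 0 (b * r.+1)),
    size J' + k'.*2 = b * m.+1 &
    forall a d, \sum_(p <- M') adj p a d = \sum_(p <- M) adj p a d
      + (\sum_z (o z == Some (Some a))) * (d == r)
      + (\sum_z (o z == Some (Some d))) * (a == r)].
Proof.
have hpo1 := po_pairs po.
move: o (po_match po) (po_half po); case: b => o hpo2 hpo3 ho; last first.
  exists M, J, k; split=> // a d.
  by rewrite !big_ord0 !mul0n !addn0.
have iotaS : perm_eq (r :: iota 0 r) (iota 0 (1 * r.+1)).
  by rewrite mul1n perm_iota_succ.
rewrite mul1n in hpo2 hpo3.
case E: (o ord0) (ho ord0) => [[a0|]|//].
  move=> aJ; exists ([:: a0; r] :: M), (rem a0 J), k; split=> //.
  - apply: perm_trans iotaS.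
    rewrite -(perm_cons r) in hpo2; apply: perm_trans hpo2.
    apply/permP=> f; rewrite /= !count_cat /= (permP (perm_to_rem aJ)) /=.
    by lia.
  - by rewrite size_rem // mul1n; case: (J) aJ hpo3 => //= *; lia.
  - move=> a d; rewrite big_cons /= addn0 !big_ord1 !E /joins.
    have eS u v : (Some (Some u) == Some (Some v)) = (u == v) by [].
    by rewrite !eS !(eq_sym r) !mulnb; lia.
move=> k0; exists M, (r :: J), k.-1; split=> //.
- by apply: perm_trans iotaS; rewrite /= perm_cons.
- by rewrite /= mul1n; lia.
- by move=> a d; rewrite !big_ord1 !E /= !mul0n !addn0.
Qed.

Lemma partial_OP_step :
  exists P' M' J' k', partial_OP b K r.+1 m.+1 P' M' J' k'.
Proof.
have [g [g1 g2 g3 g4 g5]] := slot_matching.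
have [M' [J' [k' [M1 M2 M3 M4]]]] := matching_step g4.
have nr c : r \notin flatten (P c).
  by apply/negP=> /flattenP[p pP rp]; have := lt_P po pP rp; rewrite ltnn.
have merge c := merge_words (po_size po c) (nr c) (g3 c) (g1 c) (g2 c).
have [P' HP'] := fin_all_exists merge.
exists P', M', J', k'; split=> //.
- by move=> c; have [] := HP' c.
- move=> c; have [_ H _] := HP' c.
  apply: perm_trans (perm_iota_succ r).
  have := po_perm po c; rewrite -(perm_cons r); apply: perm_trans.
  by rewrite -cat_cons -(cat1s r) -catA perm_sym perm_catCA perm_cat2l perm_sym.
pose H a := \sum_x (g x == Some (Some a)).
have HE a : H a = \sum_c \sum_i (g (inl (c, i)) == Some (Some a)) +
    \sum_z (g (inr z) == Some (Some a)).
  by rewrite /H big_sumType /= sum_pair.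
have cov_new a d : \sum_c \sum_(y <- K c) cadj y a d
    + \sum_c \sum_(p <- P' c) adj p a d + \sum_(m <- M') adj m a d
    = \sum_c \sum_(y <- K c) cadj y a d + \sum_c \sum_(p <- P c) adj p a d
      + \sum_(m <- M) adj m a d + H a * (d == r) + H d * (a == r).
  have -> : \sum_c \sum_(p <- P' c) adj p a d = \sum_c (\sum_(p <- P c) adj p a d
      + (\sum_i (g (inl (c, i)) == Some (Some a))) * (d == r)
      + (\sum_i (g (inl (c, i)) == Some (Some d))) * (a == r)).
    by apply: eq_bigr => c _; have [_ _ ->] := HP' c.
  rewrite M4 !HE.
  rewrite !big_split /= -!big_distrl /=.
  have arith (A B D x y x' y' : nat) :
    A + (B + x + y) + (D + x' + y') = A + B + D + (x + x') + (y + y') by lia.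
  by rewrite !mulnDl; exact: arith.
by move=> a d ar dr nad; rewrite cov_new; apply: (cover_extend po g5).
Qed.

End Step.

(** * Translation to and from edge sets *)

Lemma cadj_zip (T : eqType) (y : seq T) a d :
  cadj y a d = \sum_(p <- zip y (rot 1 y)) joins p.1 p.2 a d.
Proof.
case: y => [|x s]; first by rewrite big_nil.
rewrite rot1_cons; suff gen z t :
    padj z (rcons s t) a d = \sum_(p <- zip (z :: s) (rcons s t)) joins p.1 p.2 a d.
  exact: gen.
by elim: s z => [|y s IH] z /=; rewrite big_cons ?big_nil //= IH.
Qed.

Lemma mem_zip_rot1 (T : eqType) (y : seq T) a d : (a, d) \in zip y (rot 1 y) ->
  exists2 i, i < size y &
    a = nth a y i /\ d = nth a y (if i.+1 < size y then i.+1 else 0).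
Proof.
case: y => [|x s] //; rewrite rot1_cons => /(nthP (a, a))[i].
rewrite size_zip size_rcons minnn => ls; rewrite nth_zip ?size_rcons // => -[E1 E2].
exists i => //; split=> //.
rewrite -E2 nth_rcons /= ltnS; case: (ltnP i (size s)) => //= h.
have -> : i = size s by move: ls h => /=; lia.
by rewrite eqxx.
Qed.

Lemma zip_rot1_neq (T : eqType) (y : seq T) a d : uniq y -> 1 < size y ->
  (a, d) \in zip y (rot 1 y) -> a != d.
Proof.
move=> u s2 /mem_zip_rot1[i li [Ea Ed]]; rewrite Ed {1}Ea.
by rewrite nth_uniq //; case: ifP; lia.
Qed.

(** Both orders would force positions [i] and [j] to be successors of each other modulo [size y],
    which happens only for length at most two. Hence a cycle of length at least three counts each of
    its edges once. *)
Lemma zip_rot1_asym (T : eqType) (y : seq T) a d : uniq y -> 2 < size y ->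
  (a, d) \in zip y (rot 1 y) -> (d, a) \notin zip y (rot 1 y).
Proof.
move=> u s2 /mem_zip_rot1[i li [Ea Ed]]; apply/negP=> /mem_zip_rot1[j lj [Ed' Ea']].
move/eqP: Ed; rewrite {1}Ed' (set_nth_default a) // nth_uniq //; last by case: ifP; lia.
move/eqP: Ea; rewrite {1}Ea' (set_nth_default a) //; last by case: ifP; lia.
rewrite nth_uniq //; last by case: ifP; lia.
by do 2!case: ifP => ?; move=> /eqP ? /eqP ?; lia.
Qed.

Section Edges.
Variable v : nat.
Implicit Types (y : seq 'I_v) (a d : 'I_v).

Lemma set2_inj a d a' d' : [set a; d] = [set a'; d'] ->
  (a, d) = (a', d') \/ (a, d) = (d', a').
Proof.
move=> E; have : a \in [set a'; d'] by rewrite -E !inE eqxx.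
have : d \in [set a'; d'] by rewrite -E !inE eqxx orbT.
have : a' \in [set a; d] by rewrite E !inE eqxx.
have : d' \in [set a; d] by rewrite E !inE eqxx orbT.
by rewrite !inE; do 4!(case/orP=> /eqP ?); subst; auto.
Qed.

Lemma cycle_edgesE y a d : ([set a; d] \in cycle_edges y) =
  ((a, d) \in zip y (rot 1 y)) || ((d, a) \in zip y (rot 1 y)).
Proof.
apply/imsetP/orP => [[[a' d'] pz /= /set2_inj[[-> ->]|[-> ->]]]|]; auto.
by case=> pz; [exists (a, d)|exists (d, a)] => //; rewrite setUC.
Qed.

Lemma cadj_cycle_edges y a d : uniq y -> 2 < size y ->
  cadj y a d = ([set a; d] \in cycle_edges y).
Proof.
move=> u s3; rewrite cadj_zip cycle_edgesE.
have uz : uniq (zip y (rot 1 y)).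
  by apply: (@map_uniq _ _ fst); rewrite -/(unzip1 _) unzip1_zip ?size_rot.
have -> : \sum_(p <- zip y (rot 1 y)) joins p.1 p.2 a d =
    count_mem (a, d) (zip y (rot 1 y)) + count_mem (d, a) (zip y (rot 1 y)).
  elim: (zip y _) => [|[p q] z IH]; first by rewrite big_nil.
  rewrite big_cons IH /= /joins !xpair_eqE; move: (_ && _) (_ && _).
  by move=> u1 u2; rewrite addnACA.
rewrite !count_uniq_mem //.
case: (boolP ((a, d) \in _)) => // H.
by rewrite (negPf (zip_rot1_asym u s3 H)).
Qed.

Lemma cycle_edgesP y e : uniq y -> 2 < size y -> e \in cycle_edges y ->
  exists a d, a != d /\ e = [set a; d].
Proof.
move=> u s3 /imsetP[[a d] pz ->]; exists a, d; split=> //.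
by apply: zip_rot1_neq pz => //; apply: ltnW.
Qed.

Lemma sum_cadj_edges (cs : seq (seq 'I_v)) a d :
  uniq (flatten cs) -> all (fun y => 2 < size y) cs ->
  \sum_(y <- cs) cadj y a d = ([set a; d] \in \bigcup_(y <- cs) cycle_edges y).
Proof.
elim: cs => [|y cs IH] /=; first by rewrite !big_nil inE.
rewrite cat_uniq => /and3P[uy yn /IH{}IH] /andP[sy /IH{}IH].
rewrite !big_cons in_setU cadj_cycle_edges //.
case: (boolP (_ \in cycle_edges y)) => [H|_]; last by rewrite IH.
rewrite big1_seq // => z /andP[_ zcs]; rewrite cadj_notin //.
apply/negP => az; case/negP: yn; apply/hasP; exists a.
  by apply/flattenP; exists z.
move: H; rewrite cycle_edgesE => /orP[] H.
  by have := map_f fst H; rewrite -/(unzip1 _) unzip1_zip ?size_rot.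
by have := map_f snd H; rewrite -/(unzip2 _) unzip2_zip ?size_rot // mem_rot.
Qed.

Lemma bigcup_cycle_edgesP (cs : seq (seq 'I_v)) e :
  uniq (flatten cs) -> all (fun y => 2 < size y) cs ->
  e \in \bigcup_(y <- cs) cycle_edges y -> exists a d, a != d /\ e = [set a; d].
Proof.
elim: cs => [|y cs IH] /=; first by rewrite big_nil inE.
rewrite cat_uniq => /and3P[uy yn /IH{}IH] /andP[sy /IH{}IH].
by rewrite big_cons in_setU => /orP[/cycle_edgesP|/IH//]; apply.
Qed.

Lemma sum_disjoint (n : nat) (X : finType) (F : 'I_n -> {set X}) e :
  (forall i j, i != j -> [disjoint F i & F j]) ->
  \sum_i (e \in F i) = (e \in \bigcup_i F i).
Proof.
move=> dF; case: (boolP (e \in _)) => [/bigcupP[i _ eF]|nF].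
  rewrite (bigD1 i) //= eF big1 // => j ji.
  by rewrite (disjointFl (dF _ _ ji)).
by rewrite big1 // => i _; case: (boolP (_ \in _)) => // eF;
  case/bigcupP: nF; exists i.
Qed.

End Edges.

(** No vertex is missing, hence no petals and no waiting vertices: this is a solution in terms of
    counts, with [M] the removed 1-factor. *)
Definition full_OP (C : nat) (b : bool) (v : nat) (f : 'I_C -> seq (seq nat)) M :=
  partial_OP b f v 0 (fun=> [::]) M [::] 0.

Lemma enum_pair (T : finType) (e : {set T}) : #|e| = 2 ->
  exists x y, [/\ x != y, enum e = [:: x; y] & e = [set x; y]].
Proof.
rewrite cardE => s2; have := enum_uniq e; have := mem_enum e.
case: (enum e) s2 => [|x [|y [|]]] //= _ me; rewrite inE andbT => nxy.
exists x, y; split=> //; apply/setP=> z; by rewrite -me !inE.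
Qed.

Lemma joins_set2 v (x y a d : 'I_v) : x != y ->
  joins x y a d = ([set x; y] == [set a; d]).
Proof.
move=> nxy; rewrite /joins; case: (eqVneq [set x; y] [set a; d]) => [|ne].
  case/set2_inj=> -[<- <-]; rewrite !eqxx.
    by rewrite (negPf nxy).
  by rewrite (negPf nxy).
case: (boolP (_ && _)) => [/andP[/eqP E1 /eqP E2]|_].
  by rewrite E1 E2 eqxx in ne.
case: (boolP (_ && _)) => [/andP[/eqP E1 /eqP E2]|//].
by rewrite E1 E2 setUC eqxx in ne.
Qed.

Section FromSolution.
Variables (v : nat) (I : {set {set 'I_v}}).
Hypothesis I2 : forall e, e \in I -> #|e| = 2.

Lemma sum_adj_enum (a d : 'I_v) :
  \sum_(e <- enum I) adj (enum e) a d = ([set a; d] \in I).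
Proof.
rewrite -mem_enum -(count_uniq_mem _ (enum_uniq _)) -sum1_count [RHS]big_mkcond.
apply: eq_big_seq => e; rewrite mem_enum => /I2/enum_pair[x [y [nxy Ee Es]]].
rewrite Ee /= addn0 joins_set2 // Es.
by case: (_ == _).
Qed.
End FromSolution.

Lemma OP_solvable_full (w v : nat) (b : bool) ms :
  v = w.*2 + b + 1 -> OP_solvable v ms ->
  exists (f : 'I_w -> seq (seq nat)) M, full_OP b v f M /\
    forall c, map size (f c) = ms.
Proof.
move=> Ev [I [Iodd [Ieven [Fs [FsT Fsd FsU]]]]].
have oddv : odd v = ~~ b by rewrite Ev !oddD odd_double; case: b {Ev}.
have I2 e : e \in I -> #|e| = 2.
  case: (boolP (odd v)) => [/Iodd->|/Ieven[/subsetP H _ /H]]; first by rewrite inE.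
  by rewrite inE => /eqP.
set C := size Fs.
have exf (c : 'I_C) : exists cs : seq (seq 'I_v), [/\ map size cs = ms,
   all (fun c => 3 <= size c) cs, perm_eq (flatten cs) (enum 'I_v) &
   nth set0 Fs c = \bigcup_(c <- cs) cycle_edges c].
  exact: FsT (mem_nth _ (ltn_ord c)).
have [f Hf] := fin_all_exists exf.
have uf c : uniq (flatten (f c)).
  by have [_ _ /perm_uniq-> _] := Hf c; apply: enum_uniq.
pose f' c := map (map val) (f c).
pose M := map (map val) [seq enum (mem e) | e : {set 'I_v} <- enum I].
have full : full_OP b v f' M.
  split=> //.
  - move=> c; have [_ _ H _] := Hf c.
    by rewrite cats0 -map_flatten -val_enum_ord perm_map.
  - by apply/allP=> m /mapP[_ /mapP[e + ->]]; rewrite mem_enum => /I2 e2 ->; rewrite size_map -cardE e2.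
  - case: (boolP (odd v)) => ov.
      have Eb : b = false by move: ov; rewrite oddv; case: (b).
      by rewrite /M (Iodd ov) enum_set0 Eb mul0n.
    have Eb : b = true by move: ov; rewrite oddv; case: (b).
    have [_ H1] := Ieven ov.
    rewrite Eb mul1n /= /M.
    rewrite -map_flatten -val_enum_ord perm_map //.
    apply/allP=> z _; apply/eqP; rewrite /= -sum_count_flatten big_map.
    rewrite [RHS]count_uniq_mem ?enum_uniq // mem_enum -[RHS](H1 z) -sum1dep_card.
    rewrite -big_enum_cond /= [RHS]big_mkcond; apply: eq_bigr => e _.
    by rewrite count_uniq_mem ?enum_uniq // mem_enum; case: (z \in e).
  - by case: (b).
  - move=> a d av dv nad.
    pose a' := Ordinal av; pose d' := Ordinal dv.
    have nad' : a' != d' by rewrite -(inj_eq val_inj).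
    rewrite [X in _ + X + _]big1 ?addn0; last by move=> c _; rewrite big_nil.
    have -> : \sum_(m <- M) adj m a d = ([set a'; d'] \in I).
      rewrite -sum_adj_enum // !big_map; apply: eq_bigr => e _.
      by rewrite -(adj_map _ _ _ val_inj).
    have -> : \sum_c \sum_(y <- f' c) cadj y a d =
        \sum_(c < C) ([set a'; d'] \in nth set0 Fs c).
      apply: eq_bigr => c _; have [_ H3 _ ->] := Hf c.
      rewrite -sum_cadj_edges // big_map; apply: eq_bigr => e _.
      by rewrite -(cadj_map _ _ _ val_inj).
    rewrite (sum_disjoint (F := fun c : 'I_C => nth set0 Fs c)); last first.
      by move=> i j nij; apply: Fsd.
    rewrite (_ : \bigcup_i _ = Kv_edges v :\: I); last first.
      by rewrite -FsU (big_nth set0) big_mkord.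
    rewrite !inE cards2 nad'; by case: (_ \in I).
have size_f c y : y \in f' c -> 2 < size y.
  by case/mapP=> z zf ->; rewrite size_map; have [_ /allP H _ _] := Hf c; apply: H.
(* [OP_solvable] does not state the number of 2-factors; the degree of vertex 0 determines it. *)
have EC : C = w.
  have v0 : 0 < v by rewrite Ev addn1.
  have := degree_total (fun c y H => ltnW (size_f c y H)) full v0.
  rewrite big1 /=; last by move=> c _; rewrite big_nil.
  by rewrite Ev; lia.
clearbody C; subst C.
exists f', M; split=> // c; have [<- _ _ _] := Hf c.
by rewrite -map_comp; apply: eq_map => y; rewrite /= size_map.
Qed.

(** The order is a successor so that [inord] can turn numbers back into vertices. The removed graph
    is defined as the complement of all cycles; by [po_cover] its edges are those of [M], so it has
    degree [b] everywhere. *)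
Lemma full_OP_solvable (C v : nat) (b : bool) (f : 'I_C -> seq (seq nat)) M ms :
  odd v.+1 = ~~ b -> full_OP b v.+1 f M ->
  (forall c, map size (f c) = ms) -> (forall c y, y \in f c -> 2 < size y) ->
  OP_solvable v.+1 ms.
Proof.
move=> ov full fms fs; set V := v.+1 in ov full *.
pose f' c := map (map (@inord v)) (f c).
have fE c : f c = map (map val) (f' c).
  rewrite -map_comp -[LHS]map_id; apply/eq_in_map => y yf /=.
  rewrite -map_comp -[LHS]map_id; apply/eq_in_map => z zy /=.
  by rewrite inordK // (lt_K full yf zy).
have perm_f c : perm_eq (flatten (f' c)) (enum 'I_V).
  have := po_perm full c; rewrite cats0 fE -map_flatten -val_enum_ord.
  by apply: perm_map_inj; apply: val_inj.
have uf c : uniq (flatten (f' c)) by rewrite (perm_uniq (perm_f c)) enum_uniq.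
have sf c : all (fun y => 2 < size y) (f' c).
  by apply/allP=> y /mapP[z zf ->]; rewrite size_map; apply: fs zf.
pose F c := \bigcup_(y <- f' c) cycle_edges y.
have cov (a d : 'I_V) : a != d ->
   \sum_c ([set a; d] \in F c) + \sum_(m <- M) adj m a d = 1.
  move=> nad; have := po_cover full (ltn_ord a) (ltn_ord d) nad.
  rewrite [X in _ + X + _ = _]big1 ?addn0; last by move=> c _; rewrite big_nil.
  move=> <-; congr (_ + _); apply: eq_bigr => c _.
  rewrite -sum_cadj_edges // fE big_map; apply: eq_bigr => y _.
  by rewrite cadj_map //; apply: val_inj.
pose U := \bigcup_c F c.
have UF (a d : 'I_V) : a != d ->
   ([set a; d] \notin U) = \sum_(m <- M) adj m a d :> nat.
  move=> nad; have := cov a d nad; case: (boolP (_ \in U)) => [/bigcupP[c _ eF]|nU].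
    by rewrite (bigD1 c) //= eF; lia.
  rewrite big1 // => c _; case: (boolP (_ \in F c)) => // eF.
  by case/negP: nU; apply/bigcupP; exists c.
have UK : U \subset Kv_edges V.
  apply/subsetP=> e /bigcupP[c _ /(bigcup_cycle_edgesP (uf c) (sf c))].
  by case=> a [d [nad ->]]; rewrite inE cards2 nad.
have deg (a : 'I_V) : \sum_(d < V) \sum_(m <- M) adj m a d = b.
  rewrite (matching_degree full) (permP (po_match full)).
  rewrite count_uniq_mem ?iota_uniq // mem_iota add0n /=.
  by case: b {ov full}; rewrite ?mul1n ?ltn_ord ?mul0n.
exists (Kv_edges V :\: U); split; last split.
- rewrite ov; case: b deg {ov full} => // deg _.
  apply/setP=> e; rewrite !inE; apply/negP=> /andP[eU /eqP/enum_pair[x [y [nxy _ Ee]]]].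
  have := deg x; rewrite (bigD1 y) //= -UF // -Ee eU; lia.
- rewrite ov negbK => bT; rewrite bT in deg.
  split; first exact: subsetDl.
  move=> z; rewrite -[RHS](deg z).
  (* The removed edges at [z] are counted by their other end [d]. *)
  transitivity #|[set d | (d != z) && ([set z; d] \notin U)]|; last first.
    rewrite -sum1dep_card [LHS]big_mkcond; apply: eq_bigr => d _.
    have [->|nd] := eqVneq d z; last by rewrite /= -UF 1?eq_sym //; case: (_ \notin U).
    rewrite /= big1_seq // => m /andP[_ mM].
    by rewrite adj_diag // (uniq_M full mM).
  rewrite -(card_in_imset (f := fun d => [set z; d])); last first.
    move=> d1 d2; rewrite !inE => /andP[n1 _] /andP[n2 _] /set2_inj[[]//|[E1 E2]].
    by rewrite E2 eqxx in n1.
  apply: eq_card => e; rewrite !inE; apply/andP/imsetP.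
    case=> /andP[eU /eqP/enum_pair[x [y [nxy _ Ee]]]]; rewrite Ee !inE.
    case/orP=> /eqP Ez; rewrite Ez.
      by exists y; rewrite ?inE // eq_sym nxy -Ee.
    by exists x; rewrite 1?setUC // inE nxy setUC -Ee.
  case=> d; rewrite inE => /andP[nd dU] ->.
  by rewrite dU cards2 (eq_sym z) nd !inE eqxx.
- exists [seq F c | c <- enum 'I_C]; split.
  + move=> G /mapP[c _ ->]; exists (f' c); split=> //.
    by rewrite -(fms c) fE -map_comp; apply: eq_map => y; rewrite /= size_map.
  + move=> i j; rewrite size_map size_enum_ord => iC jC nij.
    have nthF h (hC : h < C) :
        nth set0 [seq F c | c <- enum 'I_C] h = F (Ordinal hC).
      rewrite (nth_map (Ordinal hC)) ?size_enum_ord //; congr F.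
      by apply: val_inj; apply: nth_enum_ord.
    rewrite (nthF _ iC) (nthF _ jC).
    (* An edge shared by two factors would be counted twice in [cov]. *)
    apply/pred0P=> e /=; apply/negP=> /andP[eFi eFj].
    have [a [d [nad Ee]]] := bigcup_cycle_edgesP (uf _) (sf _) eFi.
    have := cov a d nad; rewrite -Ee (bigD1 (Ordinal iC)) //= eFi.
    rewrite (bigD1 (Ordinal jC)) /= ?eFj; first by lia.
    by rewrite -(inj_eq val_inj) eq_sym.
  + rewrite big_map big_enum /=; apply/setP=> e; rewrite !inE -/U.
    case: (boolP (e \in U)) => [/(subsetP UK)|]; first by rewrite inE.
    by rewrite andNb.
Qed.

(** * Completing a partial solution *)

(** Holds for short words too: for a one-letter [q] both sides count the edge to [t] twice, and for
    an empty [q] the loop at [t] is excluded by [a != d]. *)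
Lemma cadj_close (T : eqType) (t : T) q a d : a != d ->
  cadj (t :: q) a d = adj q a d + ends q a * (d == t) + ends q d * (a == t).
Proof.
case: q => [|x s] nad /=.
  rewrite /joins addn0; case: (eqVneq t a) => [->|_] /=; last by rewrite andbF.
  by rewrite (negPf nad).
rewrite padj_rcons /joins !(eq_sym t) !mulnDl !mulnb.
by rewrite -!(andbC (_ == t)); lia.
Qed.

Lemma partial_OP_close C (b : bool) (K : 'I_C -> seq (seq nat)) r P M J k :
  (forall c y, y \in K c -> 1 < size y) -> r + 1 = C.*2 + b + 1 ->
  partial_OP b K r 1 P M J k ->
  exists (p : 'I_C -> seq nat) M', full_OP b r.+1 (fun c => p c :: K c) M'.
Proof.
move=> Ks rn po; pose q c := head [::] (P c).
have Pq c : P c = [:: q c].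
  by have := po_size po c; rewrite /q; case: (P c) => [|p []].
(* With one vertex missing, [po_half] makes [J] a single vertex if [b] holds and empty otherwise, so
   at most one pair is added to the 1-factor. *)
exists (fun c => r :: q c), ([seq [:: j; r] | j <- J] ++ M); split=> //.
- move=> c; rewrite cats0; apply: perm_trans (perm_iota_succ r).
  have := po_perm po c; rewrite Pq /= cats0 -(perm_cons r).
  by apply: perm_trans; rewrite perm_cons perm_catC.
- by rewrite all_cat (po_pairs po) andbT all_map; apply/allP.
- have pm := po_match po; have E := po_half po.
  case: b {rn po} pm E => pm E; last first.
    by rewrite !mul0n in pm E *; case: (J) pm E.
  rewrite !mul1n in pm E *; case: J pm E => [|j [|j' J']] pm E.
  + by exfalso; move: E => /=; lia.
  + apply: perm_trans (perm_iota_succ r); rewrite -(perm_cons r) in pm.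
    by apply: perm_trans pm; rewrite (perm_catCA [:: j] [:: r]).
  + by exfalso; move: E => /=; lia.
- by rewrite muln0.
- move=> a d ar dr nad.
  rewrite [X in _ + X + _]big1 ?addn0; last by move=> c _; rewrite big_nil.
  pose H a := \sum_c \sum_(p <- P c) ends p a + count_mem a J.
  rewrite -(cover_extend po (H := H) (fun a H => ends_total Ks po rn H) ar dr nad).
  rewrite big_cat big_map /= /H.
  have -> : \sum_c \sum_(y <- (r :: q c) :: K c) cadj y a d =
     \sum_c (\sum_(p <- P c) adj p a d + (\sum_(p <- P c) ends p a) * (d == r)
       + (\sum_(p <- P c) ends p d) * (a == r) + \sum_(y <- K c) cadj y a d).
    apply: eq_bigr => c _; rewrite big_cons cadj_close // Pq.
    by rewrite !big_cons !big_nil !addn0.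
  have -> : \sum_(j <- J) adj [:: j; r] a d =
     count_mem a J * (d == r) + count_mem d J * (a == r).
    elim: J {po H} => [|j J IH] /=; first by rewrite big_nil.
    rewrite big_cons IH /joins !(eq_sym r) !mulnDl !mulnb.
    by rewrite addn0 addnACA.
  rewrite !big_split /= -!big_distrl /= !mulnDl.
  have arith (A B D x y x' y' : nat) :
    B + x + y + A + (x' + y' + D) = A + B + D + (x + x') + (y + y') by lia.
  exact: arith.
Qed.

Lemma partial_OP_complete C (b : bool) (K : 'I_C -> seq (seq nat)) n r P M J k :
  (forall c y, y \in K c -> 1 < size y) -> r + n.+1 = C.*2 + b + 1 ->
  partial_OP b K r n.+1 P M J k ->
  exists (p : 'I_C -> seq nat) M', full_OP b (r + n.+1) (fun c => p c :: K c) M'.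
Proof.
move=> Ks; elim: n r P M J k => [|n IH] r P M J k rn po.
  by rewrite addn1; apply: partial_OP_close po.
have [P' [M' [J' [k' po']]]] := partial_OP_step Ks rn po.
by rewrite -addSnnS; apply: IH po'; rewrite addSnnS.
Qed.

(** * The initial partial solution *)

(** Group [j] receives the [j]-th of the [mu] cycles of each length. Stating the partition for all
    sums lets it transfer adjacency counts and vertex multiplicities alike. *)
Lemma split_groups mu ls (rest : seq (seq nat)) :
  map size rest = flatten [seq nseq mu l | l <- ls] ->
  exists k : 'I_mu -> seq (seq nat), (forall j, map size (k j) = ls) /\
    forall F : seq nat -> nat, \sum_(y <- rest) F y = \sum_j \sum_(y <- k j) F y.
Proof.
elim: ls rest => [|l ls IH] rest /=.
  case: rest => // _; exists (fun=> [::]); split=> // F.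
  by rewrite big_nil big1 // => j _; rewrite big_nil.
move=> E; have lemu : mu <= size rest.
  by have := congr1 size E; rewrite size_map size_cat size_nseq; lia.
have st : size (take mu rest) = mu by rewrite size_takel.
have [|k [k1 k2]] := IH (drop mu rest).
  by rewrite map_drop E drop_size_cat ?size_nseq.
exists (fun j : 'I_mu => nth [::] (take mu rest) j :: k j); split=> [j|F].
  rewrite /= k1; congr (_ :: _).
  have <- : nth 0 (map size (take mu rest)) j = size (nth [::] (take mu rest) j).
    by rewrite (nth_map [::]) ?st.
  by rewrite map_take E take_size_cat ?size_nseq // nth_nseq ltn_ord.
rewrite -[in LHS](cat_take_drop mu rest) big_cat /= k2.
rewrite (big_nth [::]) st big_mkord -big_split /=.
by apply: eq_bigr => j _; rewrite big_cons.
Qed.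

Lemma count_le1_uniq (T : eqType) (s : seq T) :
  (forall z, count_mem z s <= 1) -> uniq s.
Proof.
move=> H; apply: count_mem_uniq => z; have := H z.
by rewrite -has_pred1 has_count; case: (count_mem z s) => [|[]].
Qed.

Lemma perm_complement_iota v s : uniq s -> all (gtn v) s ->
  perm_eq (s ++ [seq z <- iota 0 v | z \notin s]) (iota 0 v).
Proof.
move=> us /allP sv; apply: uniq_perm; last first.
- move=> z; rewrite mem_cat mem_filter mem_iota add0n /=.
  by case: (boolP (z \in s)) => //= /sv.
- exact: iota_uniq.
rewrite cat_uniq us filter_uniq ?iota_uniq // andbT.
by apply/hasPn => z; rewrite mem_filter => /andP[].
Qed.

(** Uncovered vertices become one-letter petals, and empty words fill up to [n]. There is room
    because [K] misses at most [n] vertices and each word of [B] covers at least one of them. *)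
Lemma singleton_petals v n (K B : seq (seq nat)) :
  uniq (flatten K ++ flatten B) -> all (gtn v) (flatten K ++ flatten B) ->
  all (fun p => 0 < size p) B -> v <= n + size (flatten K) ->
  exists P, [/\ size P = n, perm_eq (flatten K ++ flatten P) (iota 0 v) &
    forall a d, \sum_(p <- P) adj p a d = \sum_(p <- B) adj p a d].
Proof.
set s := _ ++ _ => us sv B0 nv.
pose S := [seq z <- iota 0 v | z \notin s].
have pS := perm_complement_iota us sv.
have sB : size B <= size (flatten B).
  by elim: B B0 {s us sv S pS} => //= p B IH /andP[p0 /IH]; rewrite size_cat; lia.
have sS : size B + size S <= n.
  have : size (flatten K) + size (flatten B) + size S = v.
    by rewrite -size_cat -/s -size_cat (perm_size pS) size_iota.
  move: sB nv; move: (size B) (size S) (size (flatten B)) (size (flatten K)).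
  by clear; lia.
exists (B ++ [seq [:: z] | z <- S] ++ nseq (n - (size B + size S)) [::]); split.
- by rewrite !size_cat size_map size_nseq; lia.
- rewrite !flatten_cat catA -/s.
  have -> : flatten (nseq (n - (size B + size S)) [::]) = [::] :> seq nat.
    by elim: (_ - _).
  by rewrite cats0 flatten_map1 map_id.
- move=> a d; rewrite !big_cat /= big_map [X in _ + (X + _)]big1 ?add0n //.
  by rewrite [X in _ + X]big1_seq ?addn0 // => p /andP[_]; rewrite mem_nseq => /andP[_ /eqP->].
Qed.

Lemma pair_ord_bij w mu : exists h : 'I_(w * mu) -> 'I_w * 'I_mu, bijective h.
Proof.
have E : w * mu = #|{: 'I_w * 'I_mu}| by rewrite card_prod !card_ord.
exists (fun c => enum_val (cast_ord E c)); apply: inj_card_bij.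
  by move=> x y /enum_val_inj/cast_ord_inj.
by rewrite card_prod !card_ord.
Qed.

Lemma open_long_cycle mu v n ls (X : seq nat) rest (k : 'I_mu.+2 -> seq (seq nat)) :
  perm_eq (X ++ flatten rest) (iota 0 v) -> 1 < size X ->
  (forall F : seq nat -> nat, \sum_(y <- rest) F y = \sum_j \sum_(y <- k j) F y) ->
  (forall j, map size (k j) = ls) -> v <= n + sumn ls ->
  exists P : 'I_mu.+2 -> seq (seq nat),
    [/\ forall j, size (P j) = n,
        forall j, perm_eq (flatten (k j) ++ flatten (P j)) (iota 0 v) &
        forall a d, \sum_j \sum_(p <- P j) adj p a d = cadj X a d].
Proof.
move=> pX sX kF ks nv.
have cle z : count_mem z (X ++ flatten rest) <= (z < v).
  by rewrite (permP pX) count_uniq_mem ?iota_uniq // mem_iota.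
case: X => [|x0 s] // in pX sX cle *.
have uX : uniq (x0 :: s).
  by apply: count_le1_uniq => z; have := cle z; rewrite count_cat; lia.
(* Colour 0 takes the opened path and colour 1 the edge that closes it, a genuine edge since
   [1 < size X]. Both avoid every group [k j], whose cycles are disjoint from [X]. *)
pose B (j : 'I_mu.+2) : seq (seq nat) :=
  if val j == 0 then [:: x0 :: s] else
  if val j == 1 then [:: [:: last x0 s; x0]] else [::].
have cB j z : count_mem z (flatten (B j)) <= count_mem z (x0 :: s).
  rewrite /B; case: ifP => _; first by rewrite /= cats0.
  case: ifP => // _; rewrite [flatten _]/= [X in _ <= X]count_uniq_mem //.
  rewrite count_uniq_mem; last first.
    case: (lastP s) sX uX => // s' y _; rewrite last_rcons /= mem_rcons !inE andbT.
    by rewrite negb_or eq_sym => /andP[/andP[]].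
  case: (boolP (z \in _)) => //; rewrite !inE => /orP[] /eqP->.
    by rewrite -in_cons mem_last.
  by rewrite eqxx.
have ck j z : count_mem z (flatten (k j)) <= count_mem z (flatten rest).
  by rewrite -!sum_count_flatten kF (bigD1 j) //= leq_addr.
have ckB j z : count_mem z (flatten (k j) ++ flatten (B j)) <= (z < v).
  by have := cle z; have := cB j z; have := ck j z; rewrite !count_cat; lia.
have ex j := @singleton_petals v n (k j) (B j).
have ex' j : exists P, [/\ size P = n, perm_eq (flatten (k j) ++ flatten P) (iota 0 v) &
    forall a d, \sum_(p <- P) adj p a d = \sum_(p <- B j) adj p a d].
  apply: ex.
  - by apply: count_le1_uniq => z; apply: leq_trans (ckB j z) (leq_b1 _).
  - apply/allP=> z; rewrite -has_pred1 has_count => z0.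
    by have := leq_trans z0 (ckB j z); rewrite lt0b.
  - by rewrite /B; case: ifP => // _; case: ifP.
  - by rewrite size_flatten /shape ks.
have [P HP] := fin_all_exists ex'.
exists P; split=> [j|j|a d]; try by have [] := HP j.
rewrite (eq_bigr (fun j => \sum_(p <- B j) adj p a d)); last first.
  by move=> j _; have [_ _ ->] := HP j.
have B2 j : B (lift ord0 (lift ord0 j)) = [::] by [].
rewrite !big_ord_recl [X in _ + (_ + X)]big1; last by move=> j _; rewrite B2 big_nil.
by rewrite /B /= !big_cons !big_nil padj_rcons /= !addn0.
Qed.

Lemma full_OP_grow mu w (b : bool) x ls (f : 'I_w -> seq (seq nat)) M :
  0 < w -> 2 < sumn ls -> 1 < x -> all (fun l => 2 < l) ls ->
  full_OP b (w.*2 + b + 1) f M ->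
  (forall i, map size (f i) = x :: flatten [seq nseq mu.+2 l | l <- ls]) ->
  exists (f' : 'I_(w * mu.+2) -> seq (seq nat)) M',
    full_OP b ((w * mu.+2).*2 + b + 1) f' M' /\
    forall c, exists p ks, f' c = p :: ks /\ map size ks = ls.
Proof.
move=> w0 ls0 x1 ls3 full fs.
(* The multiplicity is [mu.+2], so [n] is the difference between the new order
   [(w * mu.+2).*2 + b + 1] and [v]. *)
set v := _ + 1 in full; pose n := (w * mu.+1).*2.
have ex (i : 'I_w) : exists kP : ('I_mu.+2 -> seq (seq nat)) * ('I_mu.+2 -> seq (seq nat)),
  [/\ forall j, map size (kP.1 j) = ls, forall j, size (kP.2 j) = n,
      forall j, perm_eq (flatten (kP.1 j) ++ flatten (kP.2 j)) (iota 0 v) &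
      forall a d, \sum_j \sum_(y <- kP.1 j) cadj y a d
        + \sum_j \sum_(p <- kP.2 j) adj p a d = \sum_(y <- f i) cadj y a d].
  have := fs i; have := po_perm full i; rewrite cats0.
  case: (f i) => [|X rest] //= pX [sX srest].
  have [k [k1 k2]] := @split_groups mu.+2 ls rest srest.
  have [||P [P1 P2 P3]] := @open_long_cycle mu v n ls X rest k pX _ k2 k1.
  - by rewrite sX.
  (* The petals fit: [n] is at least [w.*2], and [sumn ls] exceeds 2, hence covers [b + 1]. *)
  - by rewrite /n /v; case: (b); nia.
  exists (k, P); split=> //= a d.
  by rewrite big_cons k2 P3 addnC.
have [kP HkP] := fin_all_exists ex.
have [h hb] := pair_ord_bij w mu.+2.
pose K c := (kP (h c).1).1 (h c).2; pose P c := (kP (h c).1).2 (h c).2.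
have sumh (F : 'I_w -> 'I_mu.+2 -> nat) :
    \sum_c F (h c).1 (h c).2 = \sum_i \sum_j F i j.
  by rewrite pair_bigA /= (reindex h) //; apply: onW_bij.
(* The given 1-factor already matches all old vertices, so none waits, and the [n] missing ones are
   to be matched among themselves by [n / 2] edges. *)
have po : partial_OP b K v n P M [::] (b * (w * mu.+1)).
  split.
  - by move=> c; have [_ H _ _] := HkP (h c).1; apply: H.
  - by move=> c; have [_ _ H _] := HkP (h c).1; apply: H.
  - exact: (po_pairs full).
  - exact: (po_match full).
  - by rewrite /n add0n doubleMr.
  - move=> a d av dv nad; rewrite -(po_cover full av dv nad).
    rewrite (sumh (fun i j => \sum_(y <- (kP i).1 j) cadj y a d)).
    rewrite (sumh (fun i j => \sum_(p <- (kP i).2 j) adj p a d)).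
    rewrite -big_split /= [X in _ = _ + X + _]big1 ?addn0; last first.
      by move=> c _; rewrite big_nil.
    by congr (_ + _); apply: eq_bigr => i _; have [_ _ _ ->] := HkP i.
have Ksz c : map size (K c) = ls by have [H _ _ _] := HkP (h c).1; apply: H.
have K1 c y : y \in K c -> 1 < size y.
  by move/(map_f size); rewrite Ksz => /(allP ls3)/ltnW.
have n0 : 0 < n by rewrite /n double_gt0 muln_gt0 w0.
have Ev : v + n = (w * mu.+2).*2 + b + 1 by rewrite /v /n; lia.
rewrite -(prednK n0) in po Ev.
have [p [M' full']] := partial_OP_complete K1 Ev po.
exists (fun c => p c :: K c), M'; split; first by rewrite -Ev.
by move=> c; exists (p c), (K c).
Qed.

Theorem theorem4p1 (mu u x w eps : nat) (ls : seq nat) :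
  1 <= mu -> 1 <= u -> size ls = u -> 3 <= x ->
  all (fun l => 3 <= l) ls ->
  1 <= w -> (eps = 1 \/ eps = 2) ->
  x + mu * sumn ls = 2 * w + eps ->
  OP_solvable (2 * w + eps) (x :: flatten [seq nseq mu l | l <- ls]) ->
  OP_solvable (2 * w * mu + eps) ((2 * w * mu + eps - sumn ls) :: ls).
Proof.
move=> mu1 u1 sls x3 ls3 w1 epsE Ex solv.
(* For multiplicity one, [y = x] and the two problems coincide. *)
case: mu => [//|[|mu]] in mu1 Ex solv *.
  move: solv; rewrite mul1n in Ex; rewrite muln1 -[X in (X - _) :: _]Ex addnK.
  by rewrite (flatten_map1 id) map_id.
(* The flag [b] holds exactly when the order is even, that is, when a 1-factor is removed. *)
have [b Eb] : exists b : bool, eps = b.+1.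
  by case: epsE => ->; [exists false|exists true].
have E1 : 2 * w + eps = w.*2 + b + 1 by rewrite Eb; lia.
have E2 : 2 * w * mu.+2 + eps = (w * mu.+2).*2 + b + 1 by rewrite Eb; lia.
have [f [M [full fs]]] := OP_solvable_full E1 solv.
rewrite E1 in full.
have ls0 : 2 < sumn ls.
  case: (ls) ls3 sls u1 => [|l ls'] /=; first by move=> _ <-.
  by case/andP=> *; lia.
have [f' [M' [full' Hf']]] := full_OP_grow w1 ls0 (ltnW x3) ls3 full fs.
rewrite E2 addn1 in full' *.
have fs' c : map size (f' c) = (((w * mu.+2).*2 + b).+1 - sumn ls) :: ls.
  have [p [ks [Ef Eks]]] := Hf' c; rewrite Ef /= Eks; congr (_ :: _).
  have := perm_size (po_perm full' c); rewrite cats0 Ef size_iota /= size_cat.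
  by rewrite size_flatten /shape Eks => <-; rewrite addnK.
apply: (full_OP_solvable _ full') => //.
  by rewrite /= oddD odd_double; case: (b).
move=> c y /(map_f size); rewrite fs' inE => /orP[/eqP->|/(allP ls3)//].
(* The long cycle is long enough: [2 * w + eps] is at least [x + sumn ls], so its length is at least
   [x]. *)
move: Ex x3; rewrite Eb; nia.
Qed.
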